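(* Let $k\ge 1$ be a fixed integer. Let $\mathcal{C}_{HRSD}$, $\mathcal{C}_{SD}$ and $\mathcal{C}_{HID}$ denote, respectively, the classes of Harris-randomly self-decomposable, self-decomposable and Harris-infinitely divisible distributions on $\mathbb{R}$, identified with their characteristic functions (definitions in the context, all with this same $k$). Then $$\mathcal{C}_{HRSD}=\mathcal{C}_{SD}\cap\mathcal{C}_{HID}.$$ Further, whenever the characteristic function $\psi$ belongs to $\mathcal{C}_{HRSD}$, for every $c\in(0,1]$ and $p\in[0,1)$ the characteristic function $\psi_{c,p}$ in the defining relation $$\psi(t)=\psi_{c,p}(t)\,\{p+(1-p)\psi^{k}(ct)\}^{1/k},\qquad t\in\mathbb{R},$$ can be written as $$\psi_{c,p}(t)=\psi_c(t)\,\psi_p(ct),\qquad t\in\mathbb{R},$$ where $$\psi_c(t)=\frac{\psi(t)}{\psi(ct)},\qquad \psi_p(t)=\frac{\psi(t)}{\{p+(1-p)\psi^{k}(t)\}^{1/k}}.$$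
   Context: CF means the characteristic function $\psi(t)=\mathbb{E}e^{itX}$, $t\in\mathbb{R}$, of a probability distribution on $\mathbb{R}$; $\psi^k(t)=(\psi(t))^k$. Fix an integer $k\ge1$. Convention on roots: a $k$-th root $\{g(t)\}^{1/k}$ of a continuous non-vanishing complex function $g$ on $\mathbb{R}$ with $g(0)=1$ is the unique continuous branch equal to $1$ at $t=0$. For $p=0$, $\{\psi^k(t)\}^{1/k}$ is read as $\psi(t)$ and $\{\psi^k(ct)\}^{1/k}$ as $\psi(ct)$. Self-decomposable (SD): a CF $\psi$ is SD if for each $c\in(0,1]$ there exists a CF $\psi_c$ such that $\psi(t)=\psi(ct)\psi_c(t)$ for all $t$. Harris-infinitely divisible (HID): a CF $\psi$ is HID if for each $p\in(0,1)$ there exists a CF $\psi_p$ such that, with $a=1/p$, $$\psi(t)=\frac{\psi_p(t)}{\{a-(a-1)\psi_p^{k}(t)\}^{1/k}}\quad\text{for all }t.$$ Harris-randomly self-decomposable (HRSD): a CF $\psi$ is HRSD if for each $c\in(0,1]$ and each $p\in[0,1)$ there exists a CF $\psi_{c,p}$ such that $$\psi(t)=\psi_{c,p}(t)\{p+(1-p)\psi^{k}(ct)\}^{1/k}\quad\text{for all }t.$$ *)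

(* Defs.v *)
From HB Require Import structures.
From mathcomp Require Import all_boot all_order all_algebra.
From mathcomp Require Import all_classical all_reals all_analysis.
From mathcomp.real_closed Require Import complex.

Set Implicit Arguments.
Unset Strict Implicit.
Unset Printing Implicit Defensive.

Import Order.TTheory GRing.Theory Num.Theory.
Import numFieldNormedType.Exports.

Local Open Scope classical_set_scope.
Local Open Scope complex_scope.
Local Open Scope ring_scope.

(* E e^{itX} for X of law mu, the complex expectation being taken on real and
   imaginary parts: e^{itx} = cos (t x) + i sin (t x). *)
Definition charfun (R : realType) (mu : probability (measurableTypeR R) R)
    (t : R) : R[i] :=
  (\int[mu]_x cos (t * x)) +i* (\int[mu]_x sin (t * x)).

Definition is_CF (R : realType) (psi : R -> R[i]) : Prop :=
  exists mu : probability (measurableTypeR R) R, psi = charfun mu.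

(* h is the continuous branch, equal to 1 at 0, of the k-th root of the
   continuous non-vanishing function g.  The copy R[i]^o of R[i] carries the
   topology of the modulus. *)
Definition is_kroot (R : realType) (k : nat) (g h : R -> R[i]) : Prop :=
  [/\ continuous (g : R -> R[i]^o), g 0 = 1, forall t, g t != 0 &
   [/\ continuous (h : R -> R[i]^o), h 0 = 1 & forall t, h t ^+ k = g t]].

(* {g}^{1/k}.  For k > 0 at most one h satisfies is_kroot k g h.  When there is
   none (for instance when g vanishes somewhere) the root is undefined, and the
   value is the zero function.  The defining relations of HID and HRSD below
   then fail at t = 0, where psi 0 = 1: a law can only satisfy them through
   genuine roots. *)
Definition kroot (R : realType) (k : nat) (g : R -> R[i]) : R -> R[i] :=
  xget (fun=> 0) [set h | is_kroot k g h].

(* {p + (1 - p) psi^k}^{1/k}, which is read as psi when p = 0. *)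
Definition harris_root (R : realType) (k : nat) (p : R) (psi : R -> R[i])
    : R -> R[i] :=
  if p == 0 then psi
  else kroot k (fun t => p%:C + (1 - p)%:C * psi t ^+ k).

Definition SD (R : realType) : set (R -> R[i]) :=
  [set psi | is_CF psi /\
    forall c : R, 0 < c <= 1 ->
      exists2 psi_c : R -> R[i], is_CF psi_c &
        forall t, psi t = psi (c * t) * psi_c t].

Definition HID (R : realType) (k : nat) : set (R -> R[i]) :=
  [set psi | is_CF psi /\
    forall p : R, 0 < p < 1 ->
      exists2 psi_p : R -> R[i], is_CF psi_p &
        let a := p^-1 in
        forall t, psi t =
          psi_p t / kroot k (fun s => a%:C - (a - 1)%:C * psi_p s ^+ k) t].

(* The defining relation psi(t) = psi_cp(t) {p + (1 - p) psi^k(ct)}^{1/k}; the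
   root is the continuous branch for the function t |-> psi(ct). *)
Definition HRSD_rel (R : realType) (k : nat) (c p : R)
    (psi psi_cp : R -> R[i]) : Prop :=
  forall t, psi t = psi_cp t * harris_root k p (fun s => psi (c * s)) t.

Definition HRSD (R : realType) (k : nat) : set (R -> R[i]) :=
  [set psi | is_CF psi /\
    forall c p : R, 0 < c <= 1 -> 0 <= p < 1 ->
      exists2 psi_cp : R -> R[i], is_CF psi_cp & HRSD_rel k c p psi psi_cp].

(* Main.v *)
Require Import Defs.
From HB Require Import structures.
From mathcomp Require Import all_boot all_order all_algebra.
From mathcomp Require Import all_classical all_reals all_analysis.
From mathcomp Require Import measurable_realfun ring lra.
From mathcomp.real_closed Require Import complex.
Import Order.TTheory GRing.Theory Num.Theory.
Import numFieldNormedType.Exports.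
Local Open Scope classical_set_scope.
Local Open Scope complex_scope.
Local Open Scope ring_scope.

(** The Harris relation at level [p] and the Harris relation that defines
    infinite divisibility are one relation solved in two ways.  Put [a = 1 / p].
    If [psi = q * {p + (1 - p) psi^k}^(1/k)], then taking [k]-th powers and
    solving for [psi^k] shows that
    [(p + (1 - p) psi^k) * (a - (a - 1) q^k) = 1], so the root of the first
    factor is the inverse of the root of the second, and
    [psi = q / {a - (a - 1) q^k}^(1/k)]; the computation is reversible
    ([harris_inversion], [harris_duality]).  Turning an identity between [k]-th
    powers into one between continuous branches uses their uniqueness
    ([kroot_unique]).

    A Harris-randomly self-decomposable [psi] is therefore self-decomposable
    (take [p = 0]) and Harris-infinitely divisible (take [c = 1]).  Conversely,
    with [psi t = psi (c t) * psi_c t] and the Harris factor [q] of [psi], the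
    function [psi_c t * q (c t)] satisfies the relation at [(c, p)], and it is a
    characteristic function by closure under dilation and product
    ([is_CF_scale], [is_CF_mul]).

    The formula for [psi_cp] comes from dividing the defining relation by the
    root, once [psi] is known not to vanish.  That is the classical fact about
    self-decomposable laws ([SD_neq0]), proved from the inequality
    [1 - Re psi (2 t) <= 4 (1 - Re psi t)] ([Re_CF_doubling]) at a zero closest
    to the origin; given it, the root cannot vanish either, because it divides
    [psi]. *)

(** * Continuity of complex-valued functions *)

Lemma continuous_real_complex (R : realType) :
  continuous (fun r : R => (r%:C : R[i]^o)).
Proof.
move=> x; apply/(@cvgrPdist_lt _ R[i]^o) => e.
case: e => e e'; rewrite ltcE /= => /andP[/eqP -> e0].
near=> y; rewrite -rmorphB /= normc_def /=.
rewrite expr0n addr0 sqrtr_sqr ltcR.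
near: y; exact: (@cvgr_dist_lt _ R).
Unshelve. all: by end_near. Qed.

Lemma continuous_complex (R : realType) (u v : R -> R) :
  continuous u -> continuous v ->
  continuous (fun t => (u t +i* v t : R[i]^o)).
Proof.
move=> cu cv.
have -> : (fun t => (u t +i* v t : R[i]^o)) =
    (fun t => ((u t)%:C : R[i]^o) + ('i%C : R[i]^o) * (v t)%:C).
  by apply/funext => t; rewrite [LHS]complexE.
move=> t; apply: cvgD.
  exact: (cvg_comp _ _ (cu t) (@continuous_real_complex R (u t))).
apply: cvgM; first exact: cvg_cst.
exact: (cvg_comp _ _ (cv t) (@continuous_real_complex R (v t))).
Qed.

Lemma continuous_Re (R : realType) :
  continuous ((fun z => complex.Re z) : R[i]^o -> R).
Proof.
move=> z; apply/(@cvgrPdist_lt _ R _ (nbhs (z : R[i]^o))) => e e0.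
have e0' : 0 < e%:C by rewrite ltcR.
near=> w; rewrite -ltcR -raddfB; apply: (le_lt_trans (normc_ge_Re _)).
near: w; apply/nbhs_ballP; exists e%:C.
Unshelve. all: by end_near. Qed.

Lemma continuous_X (K : numFieldType) (T : topologicalType) (f : T -> K) n :
  continuous f -> continuous (fun t => f t ^+ n).
Proof.
move=> cf; elim: n => [|n IHn] t.
  by under eq_fun do rewrite expr0; exact: cvg_cst.
by under eq_fun do rewrite exprS; apply: cvgM; [exact: cf|exact: IHn].
Qed.

Lemma continuous_sum (K : numFieldType) (T : topologicalType) n
    (f : 'I_n -> T -> K) :
  (forall i, continuous (f i)) -> continuous (fun t => \sum_i f i t).
Proof.
move=> cf; rewrite (_ : (fun _ => _) = \sum_i f i); last first.
  by apply/funext => t; rewrite fct_sumE.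
elim/big_ind: _ => [t|g h cg ch t|i _]; last exact: cf.
- exact: cvg_cst.
- by apply: cvgD; [exact: cg|exact: ch].
Qed.

Lemma closed_zeros (K : numFieldType) (T : topologicalType) (f : T -> K) :
  continuous f -> closed [set t | f t = 0].
Proof.
move=> cf; apply: (@preimage_closed _ _ f [set 0]); last first.
  by apply: accessible_closed_set1; apply: hausdorff_accessible;
     exact: norm_hausdorff.
by move=> t _; exact: cf.
Qed.

(** * Continuous branches of roots *)

(** The set where two branches agree is closed, and it is also open:
    [h1^k - h2^k = 0] factors as [(h1 - h2) * S], and where [h1 = h2] the
    cofactor [S] is [k * h2^(k-1)], which is nonzero.  Hence the branches agree
    exactly where the continuous function [S] does not vanish, and connectedness
    of the line concludes. *)
Lemma kroot_unique (R : realType) (k : nat) (g h1 h2 : R -> R[i]) :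
  (0 < k)%N -> is_kroot k g h1 -> is_kroot k g h2 -> h1 = h2.
Proof.
move=> k0 [_ _ g0 [c1 h10 h1g]] [_ _ _ [c2 h20 h2g]].
pose S t := \sum_(i < k) h1 t ^+ (k.-1 - i) * h2 t ^+ i.
have Sdiff t : h1 t = h2 t <-> S t <> 0.
  have /esym : h1 t ^+ k - h2 t ^+ k = 0 by rewrite h1g h2g subrr.
  rewrite subrXX -/(S t) => /esym/eqP; rewrite mulf_eq0 subr_eq0 => h12.
  split=> [h12t|/eqP/negPf S0]; last first.
    by move: h12; rewrite S0 orbF => /eqP.
  rewrite /S h12t (eq_bigr (fun=> h2 t ^+ k.-1)); last first.
    by move=> i _; rewrite -exprD subnK// -ltnS prednK.
  rewrite sumr_const card_ord; apply/eqP.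
  rewrite -mulr_natr mulf_neq0 ?pnatr_eq0 -?lt0n// expf_neq0//.
  by apply: contraNneq (g0 t) => h2t; rewrite -h2g h2t expr0n gtn_eqF.
have cS : continuous (S : R -> R[i]^o).
  apply: (@continuous_sum R[i]^o) => i t; apply: (@cvgM R[i]^o).
    exact: (@continuous_X R[i]^o _ h1 _ c1).
  exact: (@continuous_X R[i]^o _ h2 _ c2).
have /connected_intervalP cR : is_interval [set: R] by [].
have : [set t | h1 t = h2 t] = [set: R].
  apply: cR.
  - by exists 0; rewrite /= h10 h20.
  - exists [set t | h1 t = h2 t]; last by rewrite setTI.
    rewrite (_ : mkset _ = ~` [set t | S t = 0]); last first.
      by apply/funext => t; apply/propext; exact: Sdiff.
    by apply: closed_openC; apply: closed_zeros cS.
  - exists [set t | h1 t = h2 t]; last by rewrite setTI.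
    rewrite (_ : mkset _ = [set t | h1 t - h2 t = 0]); last first.
      apply/funext => t; apply/propext.
      by split=> /= [->|/subr0_eq//]; rewrite subrr.
    apply: (@closed_zeros R[i]^o) => t.
    by apply: cvgB; [exact: c1|exact: c2].
by move=> E; apply/funext => t; have : [set: R] t by []; rewrite -E.
Qed.

Lemma kroot_eq (R : realType) (k : nat) (g h : R -> R[i]) :
  (0 < k)%N -> is_kroot k g h -> kroot k g = h.
Proof.
move=> k0 gh; apply: xget_unique => // h' gh'.
exact: (kroot_unique _ _ _ _ _ k0 gh' gh).
Qed.

(** A value of [kroot] other than the default 0 certifies a genuine root;
    this is how the defining relations, evaluated at [t = 0], force the roots
    that they mention to exist. *)
Lemma is_kroot_kroot (R : realType) (k : nat) (g : R -> R[i]) (t : R) :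
  kroot k g t != 0 -> is_kroot k g (kroot k g).
Proof.
by rewrite /kroot; case: xgetP => [h -> //|_]; rewrite eqxx.
Qed.

Lemma is_kroot_neq0 (R : realType) (k : nat) (g h : R -> R[i]) (t : R) :
  (0 < k)%N -> is_kroot k g h -> h t != 0.
Proof.
move=> k0 [_ _ g0 [_ _ hg]]; apply: contraNneq (g0 t) => ht.
by rewrite -hg ht expr0n gtn_eqF.
Qed.

Lemma is_kroot_scale (R : realType) (k : nat) (g h : R -> R[i]) (c : R) :
  is_kroot k g h -> is_kroot k (fun t => g (c * t)) (fun t => h (c * t)).
Proof.
have scale_cont (f : R -> R[i]) : continuous (f : R -> R[i]^o) ->
    continuous (fun t : R => (f (c * t) : R[i]^o)).
  move=> cf t; apply: (@cvg_comp _ _ _ _ f _ _ _ _ (cf (c * t))).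
  by apply: cvgM; [exact: cvg_cst|exact: cvg_id].
move=> [cg g1 g0 [ch h1 hg]]; split.
- exact: (scale_cont g cg).
- by rewrite -g1; congr g; exact: mulr0.
- by move=> t; exact: g0.
split.
- exact: (scale_cont h ch).
- by rewrite -h1; congr h; exact: mulr0.
- by move=> t; exact: hg.
Qed.

Lemma is_kroot_inv (R : realType) (k : nat) (g h : R -> R[i]) : (0 < k)%N ->
  is_kroot k g h -> is_kroot k (fun t => (g t)^-1) (fun t => (h t)^-1).
Proof.
move=> k0 gh; have h0 t := is_kroot_neq0 _ _ _ _ t k0 gh.
case: gh => cg g1 g0 [ch h1 hg]; split.
- by move=> t; apply: (@cvgV R[i]^o); [exact: g0|exact: cg].
- by rewrite g1 invr1.
- by move=> t; rewrite invr_eq0.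
- split.
  + by move=> t; apply: (@cvgV R[i]^o); [exact: h0|exact: ch].
  + by rewrite h1 invr1.
  + by move=> t; rewrite exprVn hg.
Qed.

(** * Characteristic functions *)

Lemma integrable_bounded (d : measure_display) (T : measurableType d)
    (R : realType) (P : probability T R) (f : T -> R) :
  measurable_fun [set: T] f -> (forall x, `|f x| <= 1) ->
  P.-integrable [set: T] (EFin \o f).
Proof.
move=> mf f1; apply: measurable_bounded_integrable => //.
  by apply: (le_lt_trans (probability_le1 _ _)); rewrite ?ltry.
exists 1; split; first exact: num_real.
by move=> M M1 x _; apply: (le_trans (f1 x)); exact: ltW.
Qed.

Lemma measurable_dilation (R : realType) (d : measure_display)
    (T : measurableType d) (F : R -> R) (X : T -> measurableTypeR R) (t : R) :
  continuous F -> measurable_fun setT X ->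
  measurable_fun setT (fun x => F (t * X x)).
Proof.
move=> cF mX; apply: (@measurableT_comp _ _ _ _ _ _ F).
  exact: continuous_measurable_fun.
exact: measurable_funM.
Qed.

Lemma integrable_dilation (R : realType) (d : measure_display)
    (T : measurableType d) (P : probability T R) (F : R -> R)
    (X : T -> measurableTypeR R) (t : R) :
  continuous F -> (forall x, `|F x| <= 1) -> measurable_fun setT X ->
  P.-integrable setT (EFin \o (fun x => F (t * X x))).
Proof.
move=> cF F1 mX; apply: integrable_bounded; first exact: measurable_dilation.
by move=> x; exact: F1.
Qed.

(** Realizes the law of a random variable on any probability space: scaled
    and summed variables then give the closure properties below. *)
Lemma is_CF_rv (R : realType) (d : measure_display) (T : measurableType d)
    (P : probability T R) (X : T -> measurableTypeR R) :
  measurable_fun setT X ->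
  is_CF (fun t => (\int[P]_x cos (t * X x)) +i* (\int[P]_x sin (t * X x))).
Proof.
move=> mX; pose Xm := isMeasurableFun.Build _ _ _ _ X mX.
pose X' : {mfun T >-> measurableTypeR R} := HB.pack X Xm.
exists (distribution P X'); apply/funext => t; rewrite /charfun /Rintegral.
rewrite !(@integral_distribution _ _ _ _ _ P X') //.
- apply/measurable_EFinP; apply: (@measurable_dilation _ _ _ sin id) => //.
  exact: continuous_sin.
- exact: (integrable_dilation _ _ _ _ _ _ _ (@continuous_sin R) (@sin_max R)).
- apply/measurable_EFinP; apply: (@measurable_dilation _ _ _ cos id) => //.
  exact: continuous_cos.
- exact: (integrable_dilation _ _ _ _ _ _ _ (@continuous_cos R) (@cos_max R)).
Qed.

Lemma is_CF_scale (R : realType) (psi : R -> R[i]) (c : R) :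
  is_CF psi -> is_CF (fun t => psi (c * t)).
Proof.
move=> [mu ->].
suff -> : (fun t => charfun mu (c * t)) =
    (fun t => (\int[mu]_x cos (t * (c * x))) +i*
              (\int[mu]_x sin (t * (c * x)))).
  by apply: is_CF_rv; exact: measurable_funM.
apply/funext => t; rewrite /charfun; congr (_ +i* _);
  by apply: eq_Rintegral => x _; rewrite mulrCA mulrA.
Qed.

Lemma is_CF0 (R : realType) (psi : R -> R[i]) : is_CF psi -> psi 0 = 1.
Proof.
move=> [mu ->]; congr (_ +i* _).
  all: under eq_Rintegral do rewrite mul0r ?cos0 ?sin0.
  by rewrite Rintegral_cst//= probability_setT mulr1.
by rewrite Rintegral_cst// mul0r.
Qed.

Lemma Rintegral_prodM (d1 d2 : measure_display) (T1 : measurableType d1)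
    (T2 : measurableType d2) (R : realType) (P : probability T1 R)
    (Q : probability T2 R) (f : T1 -> R) (g : T2 -> R) :
  measurable_fun setT f -> (forall x, `|f x| <= 1) ->
  measurable_fun setT g -> (forall y, `|g y| <= 1) ->
  \int[(P \x Q)%E]_z (f z.1 * g z.2) = (\int[P]_x f x) * \int[Q]_y g y.
Proof.
move=> mf f1 mg g1.
have ifg : (P \x Q)%E.-integrable setT (EFin \o (fun z => f z.1 * g z.2)).
  apply: integrable_bounded.
    by apply: measurable_funM; apply: measurableT_comp.
  by move=> z; rewrite normrM mulr_ile1.
rewrite /Rintegral -integral12_prod_meas1 //= /fubini_F.
have ig := @integrable_bounded _ _ _ Q g mg g1.
under eq_integral => x _.
  rewrite /=; under eq_integral do rewrite EFinM.
  rewrite integralZl// -[X in (_ * X)%E]fineK ?integrable_fin_num//.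
  over.
rewrite integralZr//; last exact: integrable_bounded.
by rewrite -[X in (X * _)%E]fineK ?integrable_fin_num//;
  exact: integrable_bounded.
Qed.

(** The product is the characteristic function of a sum of independent
    variables, built as the sum of the coordinates under the product measure;
    Fubini and the addition formulas of cos and sin do the rest. *)
Lemma is_CF_mul (R : realType) (phi psi : R -> R[i]) :
  is_CF phi -> is_CF psi -> is_CF (fun t => phi t * psi t).
Proof.
move=> [mu ->] [nu ->].
set f := (fun _ => _).
have mZ : measurable_fun setT
    (fun z : measurableTypeR R * measurableTypeR R =>
       (z.1 + z.2 : measurableTypeR R)).
  exact: measurable_funD.
suff -> : f = (fun t => (\int[(mu \x nu)%E]_z cos (t * (z.1 + z.2))) +i*
   (\int[(mu \x nu)%E]_z sin (t * (z.1 + z.2)))) by exact: is_CF_rv mZ.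
apply/funext => t; rewrite /f /charfun.
have mc := measurable_dilation R _ _ cos id t (@continuous_cos R)
  (@measurable_id _ _ _).
have ms := measurable_dilation R _ _ sin id t (@continuous_sin R)
  (@measurable_id _ _ _).
have c1 x := cos_max (t * x); have s1 x := sin_max (t * x).
have iM (u v : measurableTypeR R -> R) :
    measurable_fun setT u -> (forall x, `|u x| <= 1) ->
    measurable_fun setT v -> (forall x, `|v x| <= 1) ->
    (mu \x nu)%E.-integrable setT (EFin \o (fun z => u z.1 * v z.2)).
  move=> mu' u1 mv v1; apply: integrable_bounded.
    by apply: measurable_funM; apply: measurableT_comp.
  by move=> z; rewrite normrM mulr_ile1.
under [X in _ = X +i* _]eq_Rintegral do rewrite mulrDr cosD.
under [X in _ = _ +i* X]eq_Rintegral do rewrite mulrDr sinD.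
rewrite RintegralB//;
  [|exact: (iM _ _ mc c1 mc c1)|exact: (iM _ _ ms s1 ms s1)].
rewrite RintegralD//;
  [|exact: (iM _ _ ms s1 mc c1)|exact: (iM _ _ mc c1 ms s1)].
rewrite (Rintegral_prodM _ _ _ _ _ _ _ _ _ mc c1 mc c1).
rewrite (Rintegral_prodM _ _ _ _ _ _ _ _ _ ms s1 ms s1).
rewrite (Rintegral_prodM _ _ _ _ _ _ _ _ _ ms s1 mc c1).
rewrite (Rintegral_prodM _ _ _ _ _ _ _ _ _ mc c1 ms s1).
by simpc; congr (_ +i* _); rewrite addrC.
Qed.

(** Continuity under the integral sign, the integrands being dominated by
    the integrable constant 1. *)
Lemma is_CF_continuous (R : realType) (psi : R -> R[i]) :
  is_CF psi -> continuous (psi : R -> R[i]^o).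
Proof.
move=> [mu ->].
have cont (F : R -> R) : continuous F -> (forall x, `|F x| <= 1) ->
    continuous (fun t : R => \int[mu]_x F (t * x)).
  move=> cF F1 t.
  have mF s : measurable_fun setT (fun x : measurableTypeR R => F (s * x)).
    exact: (measurable_dilation _ _ _ F id).
  suff : {in `](t - 1), (t + 1)[%classic, continuous
      (fun s : R => \int[mu]_x F (s * x))}.
    by apply; rewrite inE /= in_itv /= ltrBlDr ltrDl ltr01.
  have intF s : `]t - 1, t + 1[%classic s ->
      mu.-integrable setT (EFin \o (fun x => F (s * x))).
    by move=> _; exact: integrable_bounded.
  apply: (continuity_under_integral measurableT intF _ (g := fun=> 1)).
  - apply/aeW => x _ s _; apply: (@cvg_comp _ _ _ _ F _ _ _ _ (cF (s * x))).
    by apply: cvgM; [exact: cvg_id|exact: cvg_cst].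
  - by apply: integrable_bounded => // x; rewrite normr1.
  - by move=> s _; apply/aeW => x _.
apply: continuous_complex.
- by apply: cont; [exact: continuous_cos|exact: cos_max].
- by apply: cont; [exact: continuous_sin|exact: sin_max].
Qed.

(** The integrated form of [1 - cos (2 x) <= 4 (1 - cos x)], in which the
    difference of the two sides is [2 (1 - cos x)^2].  If a characteristic
    function is close to 1 at [t], it cannot vanish at [2 t]. *)
Lemma Re_CF_doubling (R : realType) (psi : R -> R[i]) (t : R) : is_CF psi ->
  1 - complex.Re (psi (t + t)) <= 4 * (1 - complex.Re (psi t)).
Proof.
move=> [mu ->] /=.
have i1 : mu.-integrable setT (EFin \o (fun=> 1)).
  by apply: integrable_bounded => // x; rewrite normr1.
have ic s := integrable_dilation R _ _ mu cos id s (@continuous_cos R)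
  (@cos_max R) (@measurable_id _ _ _).
have one : \int[mu]_x 1 = 1 :> R.
  by rewrite Rintegral_cst//= probability_setT mulr1.
rewrite -[X in X - _ <= _]one -[X in _ <= _ * (X - _)]one.
rewrite -!RintegralB//; [|exact: ic..].
rewrite -RintegralZl//; last first.
  by have := integrableB measurableT i1 (ic t); apply: eq_integrable.
apply: le_Rintegral => //.
- by have := integrableB measurableT i1 (ic (t + t)); apply: eq_integrable.
- have := integrableZl measurableT 4 (integrableB measurableT i1 (ic t)).
  by apply: eq_integrable.
move=> x _; rewrite mulrDl -mulr2n cos_mulr2n.
have := sqr_ge0 (1 - cos (t * x)); rewrite sqrrB expr1n mul1r => h.
rewrite -subr_ge0; apply: (le_trans (mulr_ge0 (ler0n _ 2) h)).
by rewrite le_eqVlt; apply/orP; left; apply/eqP; rewrite mulr2n; ring.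
Qed.

(** * Zeros of self-decomposable characteristic functions *)

(** At a zero [2 a] closest to the origin on its ray, the factors [psi_c] with
    [c < 1] must vanish at [2 a], since [psi (2 c a)] is nonzero.  But
    [psi_c a], which is [psi a / psi (c a)], tends to 1 as [c] tends to 1,
    against the doubling inequality. *)
Lemma SD_neq0 (R : realType) (psi : R -> R[i]) :
  SD psi -> forall t, psi t != 0.
Proof.
move=> [cfpsi sd] t0; apply/eqP => psit0.
have cpsi := is_CF_continuous _ _ cfpsi.
have psi0 := is_CF0 _ _ cfpsi.
have cline (a : R) : continuous (fun s : R => (psi (s * a) : R[i]^o)).
  move=> s; apply: (@cvg_comp _ _ _ _ psi _ _ _ _ (cpsi (s * a))).
  by apply: cvgM; [exact: cvg_id|exact: cvg_cst].
(* The zeros on the segment from 0 to [t0], parametrized by the interval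
   from 0 to 1. *)
pose E : set R := `[0, 1]%classic `&` [set s | psi (s * t0) = 0].
have [m /set_mem[/= m01 psim] mP] : exists2 m, m \in E &
    forall s, s \in E -> (m <= s)%R.
  apply: (@compact_EVT_min _ _ id E).
  - by exists 1; split; rewrite /= ?in_itv /= ?lexx ?ler01 ?mul1r.
  - apply: compact_closedI; first exact: segment_compact.
    exact: (closed_zeros _ _ _ (cline t0)).
  - by apply: continuous_subspaceT => x; exact: cvg_id.
have m0 : 0 < m.
  rewrite lt_neqAle; have := m01; rewrite in_itv /= => /andP[-> _].
  rewrite andbT.
  by apply: contra_eqN psim => /eqP <-; rewrite mul0r psi0 oner_neq0.
have before s : 0 <= s < m -> psi (s * t0) != 0.
  move=> /andP[s0 sm]; apply/eqP => psis.
  have := sm; rewrite ltNge => /negP; apply.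
  apply: mP; apply/mem_set; split => //=; rewrite in_itv /= s0 /=.
  apply/ltW/(lt_le_trans sm).
  by move: m01; rewrite in_itv => /andP[].
pose a := m / 2 * t0.
have aaE : a + a = m * t0 by rewrite -mulrDl -splitr.
have psia : psi a != 0.
  by apply: before; rewrite divr_ge0 ?ltW //= ltr_pdivrMr // ltr_pMr // ltr1n.
have cf : complex.Re (psi a / psi (c * a)) @[c --> (1 : R)] --> (1 : R).
  have {2}-> : (1 : R) = complex.Re (psi a / psi (1 * a)).
    by rewrite mul1r divff.
  apply: (@cvg_comp _ _ _ (fun c => psi a / psi (c * a) : R[i]^o)
    (fun z : R[i]^o => complex.Re z) _ (nbhs (psi a / psi (1 * a) : R[i]^o)) _ _
    (@continuous_Re R (psi a / psi (1 * a)))).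
  apply: (@cvgM R[i]^o); first exact: cvg_cst.
  by apply: (@cvgV R[i]^o); [rewrite mul1r|exact: cline].
(* A real part above 3/4 at [a] is incompatible with the value 0 at [2 a],
   for which the doubling inequality reads [1 <= 4 (1 - Re psi_c a)]. *)
near (1 : R)^'- => c.
have c01 : 0 < c < 1.
  by apply/andP; split; near: c; [exact: nbhs_left_gt|exact: nbhs_left_lt].
have fc : 3 / 4 < complex.Re (psi a / psi (c * a)).
  near: c; apply: (cvgr_gt _ (cvg_at_left_filter cf)).
  by rewrite ltr_pdivrMr ?mul1r ?ltr_nat ?ltr0n.
have psica : psi (c * a) != 0.
  have /andP[c0 c1] := c01.
  rewrite mulrA before// mulr_ge0 ?divr_ge0 ?ltW//=.
  apply: (@lt_trans _ _ (m / 2)); first by rewrite gtr_pMl// divr_gt0.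
  by rewrite ltr_pdivrMr // ltr_pMr // ltr1n.
have /andP[c0 c1] := c01.
have [psi_c cfc psiE] := sd c ltac:(by rewrite c0 ltW).
have psicE : psi_c a = psi a / psi (c * a).
  by rewrite [psi a]psiE mulrC mulKf.
have psic0 : psi_c (a + a) = 0.
  have /esym/eqP := psiE (a + a); rewrite {3}aaE psim mulf_eq0 => /orP[|/eqP//].
  rewrite aaE mulrA (negPf (before _ _))// mulr_ge0 ?ltW//=.
  by rewrite gtr_pMl.
have := Re_CF_doubling _ _ a cfc; rewrite psic0 psicE.
move: fc; set r := complex.Re _; clearbody r => fc.
rewrite /= subr0 => rle; suff : (1 : R) < 1 by rewrite ltxx.
by lra.
Unshelve. all: by end_near. Qed.

(** * The Harris relations *)

(** With [x = q^k] and [y = psi^k], the radicands [p + (1 - p) y] and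
    [a - (a - 1) x], where [a = 1 / p], are inverse to each other as soon as
    [psi] and [q] satisfy the [k]-th power of either Harris relation. *)
Lemma harris_inversion (F : fieldType) (p x y : F) : p != 0 ->
  (y = x * (p + (1 - p) * y) ->
   (p^-1 - (p^-1 - 1) * x) * (p + (1 - p) * y) = 1) /\
  (y * (p^-1 - (p^-1 - 1) * x) = x ->
   (p + (1 - p) * y) * (p^-1 - (p^-1 - 1) * x) = 1).
Proof.
move=> p0; split=> yE.
- rewrite mulrBl -mulrA -yE; field; exact: p0.
- rewrite mulrDl -mulrA yE; field; exact: p0.
Qed.

(** The two relations define the same factor [q] of [psi].  Whichever holds,
    its root exists because [psi 0 = 1]; the radicands being inverse to each
    other, the inverse of that root is the branch required by the other
    relation. *)
Lemma harris_duality (R : realType) (k : nat) (p : R) (psi q : R -> R[i]) :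
  (0 < k)%N -> 0 < p -> psi 0 = 1 ->
  (forall t, psi t = q t * harris_root k p psi t) <->
  (forall t, psi t =
     q t / kroot k (fun s => (p^-1)%:C - (p^-1 - 1)%:C * q s ^+ k) t).
Proof.
move=> k0 p0 psi0; rewrite /harris_root gt_eqF//.
set g := fun t => p%:C + _; set G := fun t => _ - _.
have p0' : p%:C != 0 :> R[i] by rewrite fmorph_eq0 gt_eqF.
have gE t : g t = p%:C + (1 - p%:C) * psi t ^+ k by rewrite /g rmorphB rmorph1.
have GE t : G t = p%:C^-1 - (p%:C^-1 - 1) * q t ^+ k.
  have pV : (p^-1)%:C = p%:C^-1 :> R[i] by exact: fmorphV.
  by rewrite /G rmorphB rmorph1 /= pV.
split=> rel t.
- have gh : is_kroot k g (kroot k g).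
    apply: (@is_kroot_kroot _ _ _ 0); apply/eqP => h0.
    by have /eqP := rel 0; rewrite h0 mulr0 psi0 oner_eq0.
  suff GV : G = (fun s => (g s)^-1).
    rewrite (kroot_eq _ _ _ (fun s => (kroot k g s)^-1) k0) ?invrK//.
    by rewrite GV; exact: is_kroot_inv.
  case: gh => _ _ g0 [_ _ hg]; apply/funext => s.
  have psiE : psi s ^+ k = q s ^+ k * g s by rewrite rel exprMn hg.
  apply: (mulIf (g0 s)); rewrite mulVf ?g0// GE.
  move: psiE; rewrite gE; exact: (harris_inversion _ _ _ _ p0').1.
- set H := kroot k G in rel *.
  have GH : is_kroot k G H.
    apply: (@is_kroot_kroot _ _ _ 0); apply/eqP => H0.
    by have /eqP := rel 0; rewrite /H H0 invr0 mulr0 psi0 oner_eq0.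
  suff gV : g = (fun s => (G s)^-1).
    rewrite (kroot_eq _ _ _ (fun s => (H s)^-1) k0)//.
    by rewrite gV; exact: is_kroot_inv.
  case: GH => _ _ G0 [_ _ HG]; apply/funext => s.
  have psiE : psi s ^+ k * G s = q s ^+ k.
    by rewrite rel exprMn exprVn HG mulfVK// G0.
  apply: (mulIf (G0 s)); rewrite mulVf ?G0// gE.
  move: psiE; rewrite GE; exact: (harris_inversion _ _ _ _ p0').2.
Qed.

Lemma is_kroot_harris_root (R : realType) (k : nat) (p : R)
    (psi q : R -> R[i]) :
  p != 0 -> psi 0 = 1 -> (forall t, psi t = q t * harris_root k p psi t) ->
  is_kroot k (fun t => p%:C + (1 - p)%:C * psi t ^+ k) (harris_root k p psi).
Proof.
move=> p0 psi0 rel; have : harris_root k p psi 0 != 0.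
  by apply: contra_eq_neq (rel 0) => ->; rewrite mulr0 psi0 oner_neq0.
by rewrite /harris_root (negPf p0); exact: is_kroot_kroot.
Qed.

(** The relation with [q] serves to ensure that the root of
    [p + (1 - p) psi^k] exists; its dilation is then a continuous branch for the
    dilated radicand, hence the one. *)
Lemma harris_root_scale (R : realType) (k : nat) (c p : R) (psi q : R -> R[i]) :
  (0 < k)%N -> psi 0 = 1 -> (forall t, psi t = q t * harris_root k p psi t) ->
  harris_root k p (fun s => psi (c * s)) = fun t => harris_root k p psi (c * t).
Proof.
move=> k0 psi0 rel; have [->|p0] := eqVneq p 0.
  by rewrite /harris_root eqxx.
have := is_kroot_harris_root _ _ _ _ _ p0 psi0 rel.
move=> /(is_kroot_scale _ _ _ _ c) /(kroot_eq _ _ _ _ k0) <-.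
by rewrite /harris_root (negPf p0).
Qed.

(** The case [c = 1] of the defining relation. *)
Lemma HRSD_factor (R : realType) (k : nat) (psi : R -> R[i]) (p : R) :
  HRSD k psi -> 0 <= p < 1 ->
  exists2 q, is_CF q & forall t, psi t = q t * harris_root k p psi t.
Proof.
move=> [_ rsd] p01; have [|q cfq rel] := rsd 1 p _ p01.
  by rewrite ltr01 lexx.
have psi1 : (fun s => psi (1 * s)) = psi.
  by apply/funext => s; congr psi; exact: mul1r.
exists q => [|t]; first exact: cfq.
by have := rel t; rewrite psi1.
Qed.

(** The case [p = 0], where the root is read as [psi (c t)]. *)
Lemma HRSD_SD (R : realType) (k : nat) : HRSD k `<=` @SD R.
Proof.
move=> psi [cfpsi rsd]; split=> // c c01.
have [|q cfq rel] := rsd c 0 c01; first by rewrite lexx ltr01.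
exists q => [|t]; first exact: cfq.
by have := rel t; rewrite /harris_root eqxx mulrC.
Qed.

Lemma HRSD_HID (R : realType) (k : nat) : (0 < k)%N -> HRSD k `<=` @HID R k.
Proof.
move=> k0 psi hrsd; have [cfpsi _] := hrsd; split=> // p /andP[p0 p1].
have [|q cfq rel] := HRSD_factor _ _ _ p hrsd; first by rewrite ltW.
by exists q => //; apply/harris_duality => //; exact: is_CF0.
Qed.

(** Combine [psi t = psi (c t) * psi_c t] with
    [psi (c t) = q (c t) * {p + (1 - p) psi^k (c t)}^(1/k)]: the factor
    [psi_c t * q (c t)] is a product of characteristic functions. *)
Lemma SD_HID_HRSD (R : realType) (k : nat) : (0 < k)%N ->
  @SD R `&` HID k `<=` HRSD k.
Proof.
move=> k0 psi [[cfpsi sd] [_ hid]]; split=> // c p c01 /andP[p0 p1].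
have [psi_c cfc psi_cE] := sd c c01.
have psi0 := is_CF0 _ _ cfpsi.
have [->|p_neq0] := eqVneq p 0.
  by exists psi_c => // t; rewrite /harris_root eqxx mulrC.
have {}p0 : 0 < p by rewrite lt_def p_neq0.
have [|q cfq /(harris_duality _ _ _ _ _ k0 p0 psi0) rel] := hid p.
  by rewrite p0.
exists (fun t => psi_c t * q (c * t)).
  by apply: is_CF_mul => //; exact: is_CF_scale.
move=> t; rewrite (harris_root_scale _ _ c _ _ _ k0 psi0 rel).
by rewrite -mulrA -rel mulrC.
Qed.

Theorem proposition2p1 (R : realType) (k : nat) (hk : (1 <= k)%N) :
  HRSD k = @SD R `&` HID k /\
  forall psi : R -> R[i], HRSD k psi ->
  forall c p : R, 0 < c <= 1 -> 0 <= p < 1 ->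
    (forall t, psi (c * t) != 0 /\ harris_root k p psi t != 0) /\
    forall psi_cp : R -> R[i], is_CF psi_cp -> HRSD_rel k c p psi psi_cp ->
      let psi_c := fun t => psi t / psi (c * t) in
      let psi_p := fun t => psi t / harris_root k p psi t in
      forall t, psi_cp t = psi_c t * psi_p (c * t).
Proof.
split.
  apply/seteqP; split; last exact: SD_HID_HRSD.
  by move=> psi hrsd; split; [exact: HRSD_SD hrsd|exact: HRSD_HID].
move=> psi hrsd c p c01 p01.
have psi_neq0 := SD_neq0 _ _ (HRSD_SD _ _ _ hrsd).
have [q _ rel] := HRSD_factor _ _ _ p hrsd p01.
have root_neq0 t : harris_root k p psi t != 0.
  by apply: contra_neq (psi_neq0 t) => root0; rewrite rel root0 mulr0.
split=> [t|psi_cp _ rel_cp psi_c psi_p t]; first by split.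
have psi0 := is_CF0 _ _ hrsd.1.
rewrite /psi_c /psi_p mulrA mulfVK//; apply: (mulIf (root_neq0 (c * t))).
by rewrite mulfVK// [RHS]rel_cp (harris_root_scale _ _ c _ _ _ hk psi0 rel).
Qed.
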